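(* Let $\bm u\in\mathbb{C}^{Nd}$ and $\mu\in\mathbb{C}\setminus\{0\}$. Then $\bm u$ is a left eigenvector of $\mathcal N$ corresponding to the eigenvalue $\mu$ (i.e. $\bm u\neq0$ and $\bm u^*\mathcal N(\mu)=0$) if and only if $\bm u$ is a right eigenvector of $\mathcal M$ corresponding to the eigenvalue $\bar\mu$ (i.e. $\bm u\neq0$ and $\mathcal M(\bar\mu)\bm u=0$).
   Context: Setting: $A_j:\mathbb{R}\to\mathbb{R}^{d\times d}$ ($j=0,\dots,h$) smooth and $T$-periodic, $T=N\Delta$, delays $\tau_j=n_j\Delta$ with integers $0=n_0\le n_1<\cdots<n_h$. For $\mu\neq0$ the $Nd\times Nd$ matrix $A(s,\mu)$ is defined blockwise: for $\bm q=(q_1^{\mathrm T},\ldots,q_N^{\mathrm T})^{\mathrm T}$ the $n$-th block of $A(s,\mu)\bm q$ is $\Delta\sum_{j=0}^h A_j((s+n-1)\Delta)\mu^{a_{n-n_j}}q_{b_{n-n_j}}$, with $a_k=\lfloor(k-1)/N\rfloor$, $b_k=((k-1)\bmod N)+1$. Let $B(\mu)=\begin{pmatrix}0&I_{N-1}\\ \mu&0\end{pmatrix}\otimes I_d$. Define $\mathcal N(\mu)\bm v=\bm q(1)-B(\mu)\bm v$ where $\dot{\bm q}(s)=A(s,\mu)\bm q(s)$ on $[0,1]$, $\bm q(0)=\bm v$. Define the ''transposed'' problem $\mathcal M(\mu)\bm v=\bm p(0)-B(\mu)^{\mathrm T}\bm v$, where $\bm p$ solves $\dot{\bm p}(s)=-A(s,\mu)^{\mathrm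 T}\bm p(s)$, $s\in[0,1]$, $\bm p(1)=\bm v$. Here ${}^*$ denotes conjugate transpose and $\bar\mu$ complex conjugate. *)

(* Defs.v *)
From HB Require Import structures.
From mathcomp Require Import all_boot all_order all_algebra.
From mathcomp Require Import all_classical all_reals all_analysis.
From mathcomp Require Import complex.
Set Implicit Arguments. Unset Strict Implicit. Unset Printing Implicit Defensive.
Import Order.TTheory GRing.Theory Num.Theory.
Import numFieldNormedType.Exports.
Local Open Scope ring_scope.
Local Open Scope classical_set_scope.

Section DDE.
Variable R : realType.
Notation C := (R[i]).

(* Data: dimension d, number of subintervals N, step Delta, h delays with
   multiplicities nj : 'I_(h.+1) -> nat, coefficient functions Aj. *)
Variables (d N h : nat) (Delta : R) (nj : 'I_h.+1 -> nat)
          (Aj : 'I_h.+1 -> R -> 'M[R]_d).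

(* a_k = floor((k-1)/N), b_k = ((k-1) mod N) + 1; with 0-based block index
   n' = n - 1 we have k - 1 = n' - n_j.  The exponent is an integer. *)
Definition a_idx (k : int) : int := ((k - 1) %/ (N : int))%Z.
(* 0-based version of b_k, i.e. b_k - 1 *)
Definition b_idx0 (k : int) : int := ((k - 1) %% (N : int))%Z.

Definition cplx_mx (M : 'M[R]_d) : 'M[C]_d := map_mx (fun x => (x%:C)%C) M.

(* Vectors of C^{Nd} are columns; block n (0-based, n < N), component r < d
   sits at index mxvec_index n r = n*d + r. *)
Definition blk (n : 'I_N) (r : 'I_d) : 'I_(N * d) := mxvec_index n r.

(* The matrix A(s, mu): for 0-based block n (i.e. block n+1 of the paper),
   the n-th block of A q is
   Delta * sum_j A_j((s+n)Delta) mu^(a_{n+1-n_j}) q_{b_{n+1-n_j}}. *)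
Definition Amx (s : R) (mu : C) : 'M[C]_(N * d) :=
  \sum_(n < N) \sum_(j < h.+1) \sum_(m < N | (m : int) == b_idx0 (n.+1%:Z - (nj j)%:Z))
    \sum_(r < d) \sum_(c < d)
      ((Delta%:C)%C * mu ^ (a_idx (n.+1%:Z - (nj j)%:Z))
        * cplx_mx (Aj j ((s + n%:R) * Delta)) r c)
      *: delta_mx (blk n r) (blk m c).

(* B(mu) = [[0, I_{N-1}], [mu, 0]] (x) I_d *)
Definition Bsmall (mu : C) : 'M[C]_N :=
  \matrix_(n < N, m < N)
    (if n.+1 == m :> nat then 1
     else if (n == N.-1 :> nat) && (m == 0 :> nat) then mu else 0).
Definition Bmx (mu : C) : 'M[C]_(N * d) :=
  \sum_(n < N) \sum_(m < N) \sum_(r < d) (Bsmall mu n m) *: delta_mx (blk n r) (blk m r).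

Definition has_cderiv (f : R -> C) (s : R) (z : C) : Prop :=
  is_derive s 1 (fun t => complex.Re (f t)) (complex.Re z) /\ is_derive s 1 (fun t => complex.Im (f t)) (complex.Im z).

Definition ccont_on01 (f : R -> C) : Prop :=
  {within [set t : R | 0 <= t <= 1], continuous (fun t => complex.Re (f t))} /\
  {within [set t : R | 0 <= t <= 1], continuous (fun t => complex.Im (f t))}.

Definition is_lin_sol (F : R -> 'M[C]_(N * d)) (q : R -> 'cV[C]_(N * d)) : Prop :=
  (forall i, ccont_on01 (fun t => q t i 0)) /\
  (forall s, 0 < s < 1 -> forall i,
     has_cderiv (fun t => q t i 0) s ((F s *m q s) i 0)).

Definition Nop (mu : C) (v : 'cV[C]_(N * d)) : 'cV[C]_(N * d) :=
  xget 0 [set w | exists q, is_lin_sol (fun s => Amx s mu) q /\ q 0 = v /\ w = q 1]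
  - Bmx mu *m v.

Definition Mop (mu : C) (v : 'cV[C]_(N * d)) : 'cV[C]_(N * d) :=
  xget 0 [set w | exists p, is_lin_sol (fun s => - (Amx s mu)^T) p /\ p 1 = v /\ w = p 0]
  - (Bmx mu)^T *m v.

End DDE.

Definition adjmx (R : realType) m n (M : 'M[R[i]]_(m, n)) : 'M[R[i]]_(n, m) :=
  (map_mx (@conjc R) M)^T.

Definition smooth_fun (R : realType) (f : R -> R) : Prop :=
  forall k x, derivable (derive1n k f) x 1.

(* Main.v *)
(* If q' = A(s, mu) q and p' = - A(s, conj mu)^T p, then p^* q is constant on
   [0,1], because A(s, conj mu) is the entrywise conjugate of A(s, mu).  With
   q(0) = v and p(1) = u this reads u^* q(1) = p(0)^* v, so that
   u^* (N(mu) v) = (M(conj mu) u)^* v for all u and v.  Both N and M pick the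
   endpoint of some solution, so solutions must be known to exist (Picard
   iteration, after splitting into real and imaginary parts); their uniqueness
   is not needed, since the identity holds whichever endpoint is picked. *)
Require Import Defs.
From HB Require Import structures.
From mathcomp Require Import all_boot all_order all_algebra.
From mathcomp Require Import all_classical all_reals all_analysis.
From mathcomp Require Import complex.
From mathcomp Require Import ring lra.
Import Order.TTheory GRing.Theory Num.Theory.
Import numFieldNormedType.Exports.
Local Open Scope ring_scope.

(** * Existence for real linear systems with continuous coefficients on [0,1] *)

Section LinearODE.
Variable R : realType.
Implicit Types (f g : R -> R) (x t : R).

(** The retraction of the line onto [0,1]. Precomposing with it extends functions controlled only on
    [0,1] to the whole line, so that continuity can be stated there without restricting the
    domain. *)
Definition clamp x : R := Num.min (Num.max x 0) 1.

Lemma clamp_itv x : 0 <= clamp x <= 1.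
Proof. by rewrite /clamp le_min le_max lexx orbT ler01 ge_min lexx orbT. Qed.

Lemma clamp_id x : 0 <= x <= 1 -> clamp x = x.
Proof. by case/andP=> x0 x1; rewrite /clamp (max_idPl x0) (min_idPl x1). Qed.

Lemma continuous_clamp : continuous clamp.
Proof.
move=> x; apply: (@continuous_min R R (id \max cst 0) (cst 1)).
  by apply: (@continuous_max R R id (cst 0)); [exact: id | exact: cst_continuous].
exact: cst_continuous.
Qed.

Lemma continuous_sum (I : Type) (r : seq I) (F : I -> R -> R) :
  (forall i, continuous (F i)) -> continuous (fun t => \sum_(i <- r) F i t).
Proof.
move=> cF; elim: r => [|i r IH] x.
  under eq_fun do rewrite big_nil; exact: cst_continuous.
under eq_fun do rewrite big_cons.
exact: (continuousD (cF i x) (IH x)).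
Qed.

Lemma bounded_on01 f : continuous f ->
  exists2 K, 0 <= K & forall t, 0 <= t <= 1 -> `|f t| <= K.
Proof.
move=> cf; have cnf : continuous (fun t => `|f t|).
  by move=> x; apply: (@continuous_comp _ _ _ f Num.norm); [exact: cf | exact: norm_continuous].
have [c _ Hc] := EVT_max (@ler01 R) (continuous_subspaceT cnf).
by exists `|f c|.
Qed.

Lemma bounded_on01_fin (I : finType) (F : I -> R -> R) :
  (forall i, continuous (F i)) ->
  exists2 K, 0 <= K & forall i t, 0 <= t <= 1 -> `|F i t| <= K.
Proof.
move=> cF; have /choice[K HK] : forall i, exists K,
    0 <= K /\ forall t, 0 <= t <= 1 -> `|F i t| <= K.
  by move=> i; have [K K0 HK] := bounded_on01 (F i) (cF i); exists K.
(* The sum of the individual bounds dominates each of them, and it makes sense even when [I] is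
   empty. *)
exists (\sum_i K i); first by apply: sumr_ge0 => i _; exact: (HK i).1.
move=> i t t01; apply: le_trans ((HK i).2 t t01) _.
by rewrite (bigD1 i)//= lerDl sumr_ge0// => j _; exact: (HK j).1.
Qed.

(* The Lebesgue primitive from -1 is differentiable only to the right of -1;
   clamping its argument makes it continuous on the whole line. *)
Lemma antiderivative_exists f : continuous f ->
  exists F : R -> R, [/\ continuous F, F 0 = 0 &
    forall t, 0 < t < 1 -> is_derive t 1 F (f t)].
Proof.
move=> cf.
have intf (u : R) : lebesgue_measure.-integrable `[-1, u] (EFin \o f).
  apply: continuous_compact_integrable; first exact: segment_compact.
  exact: continuous_subspaceT.
pose P x : R := \int[lebesgue_measure]_(t in `[-1, x]) f t.
have dP x : -1 < x -> is_derive x 1 P (f x).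
  move=> x1; have xu : x < x + 1 by rewrite ltrDl.
  have [dP <-] := continuous_FTC1_closed xu (intf _) x1 (cf x).
  by rewrite derive1E; exact: derivableP.
exists (fun x => P (clamp x) - P 0); split.
- have cP : continuous (P \o clamp).
    move=> x; apply: continuous_comp; first exact: continuous_clamp.
    apply/differentiable_continuous/derivable1_diffP.
    have /dP[] // : -1 < clamp x.
    by apply: lt_le_trans (ltrN10 _) _; have /andP[] := clamp_itv x.
  by move=> x; exact: (continuousB (cP x) (@cst_continuous _ _ _ x)).
- by rewrite clamp_id ?subrr// lexx ler01.
- move=> t /andP[t0 t1].
  have dt : is_derive t 1 (fun x => P x - P 0) (f t).
    have := dP t (lt_trans (ltrN10 _) t0) => ?.
    by apply: is_derive_eq; rewrite subr0.
  apply: near_eq_is_derive dt.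
  near=> x; rewrite clamp_id//; apply/andP; split; apply: ltW; near: x.
    exact: lt_nbhsr.
  exact: lt_nbhsl.
Unshelve. all: by end_near.
Qed.

(** For s = 1 and s = -1 the function g - s f has nonnegative derivative dg - s df, so the mean
    value theorem makes its increment from 0 to t nonnegative. The two signs together bound the
    absolute value. *)
Lemma norm_le_of_derive f df g dg : continuous f -> continuous g ->
  (forall t, 0 < t < 1 -> is_derive t 1 f (df t)) ->
  (forall t, 0 < t < 1 -> is_derive t 1 g (dg t)) ->
  (forall t, 0 < t < 1 -> `|df t| <= dg t) ->
  forall t, 0 <= t <= 1 -> `|f t - f 0| <= g t - g 0.
Proof.
move=> cf cg Df Dg le_df t /andP[]; rewrite le_eqVlt => /predU1P[<- _|t0 t1].
  by rewrite !subrr normr0.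
have in01 x : x \in `]0, t[ -> 0 < x < 1.
  by rewrite in_itv/= => /andP[-> /lt_le_trans->].
have aux (s : R) : `|s| = 1 -> s * (f t - f 0) <= g t - g 0.
  move=> s1; pose e x := g x - s * f x.
  have De x : x \in `]0, t[ -> is_derive x 1 e (dg x - s * df x).
    move=> /in01 x01; have := Df x x01; have := Dg x x01 => ? ?.
    exact: is_derive_eq.
  have ce : continuous e.
    by move=> x; exact: (continuousB (cg x) (continuousM (@cst_continuous _ _ _ x) (cf x))).
  have [c /in01 c01] := MVT t0 De (continuous_subspaceT ce).
  rewrite /e subr0 => eE; rewrite -subr_ge0.
  have -> : g t - g 0 - s * (f t - f 0) = (dg c - s * df c) * t.
    by rewrite -eE; ring.
  rewrite mulr_ge0 ?(ltW t0)// subr_ge0; apply: le_trans (le_df c c01).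
  by apply: le_trans (ler_norm _) _; rewrite normrM s1 mul1r.
rewrite ler_norml; apply/andP; split.
  by rewrite lerNl -mulN1r; apply: aux; rewrite normrN1.
by rewrite -[leLHS]mul1r; apply: aux; rewrite normr1.
Qed.

(** The radius 2 C / 2^n is the sum of all steps from the n-th on. Hence the intervals
    [u n - 2 C / 2^n, u n + 2 C / 2^n] are nested, and the supremum of their left ends lies in every
    one of them. *)
Lemma limit_of_halving_steps (u : nat -> R) (C : R) :
  (forall n, `|u n.+1 - u n| <= C / 2 ^+ n) ->
  exists l, forall n, `|l - u n| <= 2 * C / 2 ^+ n.
Proof.
move=> Hu; pose w n := u n - 2 * C / 2 ^+ n; pose z n := u n + 2 * C / 2 ^+ n.
have half n : 2 * C / 2 ^+ n = C / 2 ^+ n + 2 * C / 2 ^+ n.+1.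
  by rewrite exprS; field; rewrite expf_neq0.
have wS n : w n <= w n.+1.
  by have := Hu n; rewrite /w (half n) ler_norml; move: (C / _) (_ * C / _) => a b /andP[? ?]; lra.
have zS n : z n.+1 <= z n.
  by have := Hu n; rewrite /z (half n) ler_norml; move: (C / _) (_ * C / _) => a b /andP[? ?]; lra.
have C0 : 0 <= C by have := le_trans (normr_ge0 _) (Hu 0); rewrite expr0 divr1.
have wz n : w n <= z n.
  by rewrite /w /z lerD2l -subr_ge0 opprK addr_ge0// divr_ge0// mulr_ge0.
have wmono := homo_leq lexx le_trans wS.
have zmono := homo_leq (r := fun x y : R => y <= x) lexx (fun y x z h1 h2 => le_trans h2 h1) zS.
have wlez m n : w m <= z n.
  case: (leqP m n) => [mn|/ltnW nm].
    exact: le_trans (wmono _ _ mn) (wz n).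
  exact: le_trans (wz m) (zmono _ _ nm).
exists (sup (range w)) => n.
have ub m : ubound (range w) (z m) by move=> _ [k _ <-]; exact: wlez.
have l1 : w n <= sup (range w).
  by apply: ub_le_sup; [exists (z 0); exact: ub | exists n].
have l2 : sup (range w) <= z n by apply: ge_sup; [exists (w 0), 0 | exact: ub].
move: l1 l2; rewrite /w /z ler_norml; move: (_ * C / _) => a ? ?.
by apply/andP; split; lra.
Qed.

Lemma exists_halving_lt (K e : R) : 0 < e -> exists n, K / 2 ^+ n < e.
Proof.
move=> e0; exists (Num.Def.archi_bound (K / e)).
rewrite ltr_pdivrMr ?exprn_gt0// -ltr_pdivrMl// mulrC.
exact: upper_nthrootP.
Qed.

Lemma norm_sum_mul_le (I : finType) (a x : I -> R) (K B : R) : 0 <= K ->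
  (forall j, `|a j| <= K) -> (forall j, `|x j| <= B) ->
  `|\sum_j a j * x j| <= #|I|%:R * K * B.
Proof.
move=> K0 aK xB; apply: le_trans (ler_norm_sum _ _ _) _.
apply: (@le_trans _ _ (\sum_(j : I) K * B)); last first.
  by rewrite sumr_const -mulrA mulr_natl.
by apply: ler_sum => j _; rewrite normrM ler_pM.
Qed.

(** * Picard iteration *)

Section Picard.
Variables (I : finType) (a : I -> I -> R -> R) (v : I -> R).
Hypothesis ca : forall i j, continuous (a i j).

Let field (w : I -> R -> R) i t := \sum_j a i j t * w j t.

Let continuous_field w i : (forall j, continuous (w j)) -> continuous (field w i).
Proof.
move=> cx; apply: (@continuous_sum _ _ (fun j t => a i j t * w j t)) => j t.
exact: (continuousM (ca i j t) (cx j t)).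
Qed.

Let fieldB w z i t : field w i t - field z i t =
  field (fun j s => w j s - z j s) i t.
Proof. by rewrite /field -sumrB; apply: eq_bigr => j _; rewrite mulrBr. Qed.

(** The iterates of the integral operator [step] converge at a geometric rate, uniformly on [0,1].
    Their limit is a fixed point of [step] there, and a fixed point solves the system. *)
Lemma linear_ode_exists_from0 : exists q : I -> R -> R,
  [/\ forall i, continuous (q i), forall i, q i 0 = v i &
   forall t, 0 < t < 1 -> forall i,
     is_derive t 1 (q i) (\sum_j a i j t * q j t)].
Proof.
have [K K0 aK] := @bounded_on01_fin (I * I)%type (fun p => a p.1 p.2)
  (fun p => ca p.1 p.2).
(* [L] is a Lipschitz constant of the right-hand side for the maximum norm. *)
pose L := #|I|%:R * K; have L0 : 0 <= L by rewrite mulr_ge0.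
have field_le (w : I -> R -> R) B i t : 0 <= t <= 1 ->
    (forall j, `|w j t| <= B) -> `|field w i t| <= L * B.
  by move=> t01; apply: norm_sum_mul_le => // j; exact: (aK (i, j)).
(* The choice ranges over all functions, with f itself as a junk value when f is not continuous;
   this makes [step] a total operation that can be iterated. *)
have /choice[A HA] : forall f : R -> R, exists F : R -> R, continuous f ->
    [/\ continuous F, F 0 = 0 & forall t, 0 < t < 1 -> is_derive t 1 F (f t)].
  move=> f; have [cf|] := pselect (continuous f); last by exists f.
  by have [F HF] := antiderivative_exists f cf; exists F.
pose step w i t := v i + A (field w i) t.
have step_cont w : (forall i, continuous (w i)) -> forall i, continuous (step w i).
  move=> cx i t; have [cA _ _] := HA _ (continuous_field w i cx).
  exact: (continuousD (@cst_continuous _ _ _ t) (cA t)).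
have step0 w : (forall i, continuous (w i)) -> forall i, step w i 0 = v i.
  by move=> cx i; have [_ A0 _] := HA _ (continuous_field w i cx); rewrite /step A0 addr0.
have step_deriv w : (forall i, continuous (w i)) -> forall i t, 0 < t < 1 ->
    is_derive t 1 (step w i) (field w i t).
  move=> cx i t t01; have [_ _ /(_ t t01) dA] := HA _ (continuous_field w i cx).
  by apply: (is_derive_eq (is_deriveD (is_derive_cst (v i) t 1) dA)); rewrite add0r.
pose S n := iter n step (fun i _ => v i).
have cS n i : continuous (S n i).
  by elim: n i => [|n IH] i; [move=> t; exact: cst_continuous | exact: step_cont].
have [V V0 HV] := @bounded_on01_fin I (fun i t => S 1 i t - S 0 i t)
  (fun i t => continuousB (cS 1 i t) (cS 0 i t)).
(* With the weight [expR (2 L t)] each Picard step halves the distance, so a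
   single geometric estimate covers the whole interval. *)
pose g n t := V / 2 ^+ n * expR (2 * L * t).
have cg n : continuous (g n).
  move=> t; apply: (continuousM (@cst_continuous _ _ _ t)).
  apply: (@continuous_comp _ _ _ (fun t => 2 * L * t) expR); last exact: continuous_expR.
  exact: (continuousM (@cst_continuous _ _ _ t) (fun A => id)).
have dg n t : is_derive t 1 (g n) (2 * L * g n t).
  have d1 : is_derive t 1 (fun s : R => 2 * L * s) (2 * L).
    by apply: is_derive_eq; exact: mulr1.
  have d2 := is_derive1_comp (is_derive_expR (2 * L * t)) d1.
  apply: (is_derive_eq (is_deriveZ (V / 2 ^+ n) d2)).
  by rewrite /g /GRing.scale/=; ring.
have g_ge0 n t : 0 <= g n t by rewrite mulr_ge0 ?expR_ge0// divr_ge0.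
(* Here B bounds the distance of w and z at time t, so [dG] dominates the derivative of the
   difference of the two images. The growth function G will be [g n.+1] when comparing iterates, and
   linear when comparing the limit with an iterate. *)
have step_le w z G dG : (forall i, continuous (w i)) -> (forall i, continuous (z i)) ->
    continuous G -> (forall t, is_derive t 1 G (dG t)) ->
    (forall t, 0 <= t <= 1 -> exists2 B, L * B <= dG t & forall j, `|w j t - z j t| <= B) ->
    forall i t, 0 <= t <= 1 -> `|step w i t - step z i t| <= G t - G 0.
  move=> cw cz cG DG wz i t t01.
  have cwz : continuous (fun s => step w i s - step z i s).
    by move=> s; exact: (continuousB (step_cont w cw i s) (step_cont z cz i s)).
  have := @norm_le_of_derive _ (fun s => field w i s - field z i s) G dG cwz cG _ _ _ t t01.
  rewrite !step0// subrr subr0; apply => // s s01.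
    have := step_deriv w cw i s s01; have := step_deriv z cz i s s01 => ? ?.
    exact: is_derive_eq.
  have s01' : 0 <= s <= 1 by case/andP: s01 => /ltW-> /ltW->.
  have [B LB wzB] := wz s s01'; apply: le_trans LB.
  by rewrite fieldB; exact: field_le.
have S_le n i t : 0 <= t <= 1 -> `|S n.+1 i t - S n i t| <= g n t.
  elim: n i t => [|n IH] i t t01.
    apply: le_trans (HV i t t01) _; rewrite /g expr0 divr1 ler_peMr//.
    by rewrite -[leLHS]expR0 ler_expR !mulr_ge0//; case/andP: t01.
  apply: (@le_trans _ _ (g n.+1 t - g n.+1 0)); last by rewrite gerBl.
  apply: (step_le _ _ _ _ (cS n.+1) (cS n) (cg n.+1) (dg n.+1)) => // s s01.
  (* The derivative 2 L [g n.+1] is exactly L [g n]: the factor 2 in the exponent pays for the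
     halving. *)
  exists (g n s); last by move=> j; exact: IH.
  by rewrite /g exprS le_eqVlt; apply/orP; left; apply/eqP; field; rewrite expf_neq0.
pose C := V * expR (2 * L).
have S_leC i t n : 0 <= t <= 1 -> `|S n.+1 i t - S n i t| <= C / 2 ^+ n.
  move=> t01; apply: le_trans (S_le n i t t01) _.
  rewrite /g /C mulrAC ler_pM2r ?invr_gt0 ?exprn_gt0//.
  rewrite ler_wpM2l// ler_expR ler_piMr ?mulr_ge0//; case/andP: t01 => //.
(* Taking the limit at [clamp t] gives an estimate valid for every real t, hence a limit defined and
   continuous on the whole line. *)
have /choice[q0 Hq0] : forall p : I * R, exists l, forall n,
    `|l - S n p.1 (clamp p.2)| <= 2 * C / 2 ^+ n.
  move=> [i t]; apply: limit_of_halving_steps => n; apply: S_leC; exact: clamp_itv.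
pose q i t := q0 (i, t).
have q_le i t n : `|q i t - S n i (clamp t)| <= 2 * C / 2 ^+ n := Hq0 (i, t) n.
have cq i : continuous (q i).
  move=> t; apply/cvgrPdist_le => e e0.
  (* One third of e for each of the two distances from [q] to [S n], and one third for the variation
     of [S n] composed with [clamp]. *)
  have [n Hn] := @exists_halving_lt (2 * C) (e / 3) (divr_gt0 e0 (ltr0Sn _ _)).
  have cSc : {for t, continuous (S n i \o clamp)}.
    by apply: continuous_comp; [exact: continuous_clamp | exact: cS].
  have /cvgrPdist_le/(_ (e / 3) (divr_gt0 e0 (ltr0Sn _ _))) := cSc.
  apply: filterS => s /=.
  have := q_le i t n; have := q_le i s n; move: Hn; move: (2 * C / _) => b.
  rewrite !ler_norml => ? /andP[? ?] /andP[? ?] /andP[? ?].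
  by apply/andP; split; lra.
(* Compare both sides with [S n.+1], the image of [S n] under [step]. The two distances are at most
   L (2 C) / 2^n and 2 C / 2^n, so a positive distance between [step q] and [q] would contradict
   their sum being arbitrarily small. *)
have rq i t : 0 <= t <= 1 -> step q i t = q i t.
  move=> t01; apply/eqP; rewrite -subr_eq0 -normr_le0 leNgt; apply/negP.
  move=> /(exists_halving_lt (L * (2 * C) + 2 * C))[n]; apply/negP; rewrite -leNgt.
  rewrite -(subrKA (S n.+1 i t)); apply: le_trans (ler_normD _ _) _.
  rewrite mulrDl; apply: lerD; last first.
    rewrite distrC -{2}(clamp_id t t01); apply: le_trans (q_le i t n.+1) _.
    rewrite ler_wpM2l ?mulr_ge0 ?expR_ge0// lef_pV2 ?posrE ?exprn_gt0//.
    by rewrite ler_weXn2l// ler1n.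
  pose k := L * (2 * C) / 2 ^+ n.
  have cG : continuous (fun s : R => k * s).
    by move=> s; exact: (continuousM (@cst_continuous _ _ _ s) (fun A => id)).
  have DG (s : R) : is_derive s 1 (fun s : R => k * s) k.
    by apply: is_derive_eq; exact: mulr1.
  apply: (@le_trans _ _ (k * t - k * 0)).
    apply: (step_le _ _ _ _ cq (cS n) cG DG) => // s s01.
    exists (2 * C / 2 ^+ n); first by rewrite /k mulrA.
    by move=> j; rewrite -{2}(clamp_id s s01); exact: q_le.
  rewrite mulr0 subr0 -/k ler_piMr//; last by case/andP: t01.
  by rewrite /k divr_ge0// !mulr_ge0// expR_ge0.
(* The witness is [step q] because its initial value and derivative come directly from the
   antiderivative. Its agreement with [q] on [0,1] then only has to be used pointwise, in the
   right-hand side. *)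
exists (step q); split.
- exact: step_cont.
- exact: step0.
- move=> t t01 i; apply: (is_derive_eq (step_deriv q cq i t t01)).
  apply: eq_bigr => j _; rewrite rq//.
  by case/andP: t01 => /ltW-> /ltW->.
Qed.

End Picard.

(** A condition at time 1, as in the transposed problem, reduces to one at time 0 by the reversal t
    -> 1 - t, which replaces a(t) by - a(1 - t). *)
Lemma linear_ode_exists (I : finType) (a : I -> I -> R -> R) (v : I -> R) t0 :
  (forall i j, continuous (a i j)) -> t0 = 0 \/ t0 = 1 ->
  exists q : I -> R -> R,
  [/\ forall i, continuous (q i), forall i, q i t0 = v i &
   forall t, 0 < t < 1 -> forall i,
     is_derive t 1 (q i) (\sum_j a i j t * q j t)].
Proof.
move=> ca [->|->]; first exact: linear_ode_exists_from0.
have crev : continuous (fun t : R => 1 - t).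
  by move=> t; exact: (continuousB (@cst_continuous _ _ _ t) (fun A => id)).
have [i j t|q [cq q0 dq]] := @linear_ode_exists_from0 I
    (fun i j t => - a i j (1 - t)) v.
  apply: (@continuousN _ _ _ (a i j \o (fun s : R => 1 - s))).
  by apply: continuous_comp; [exact: crev | exact: ca].
exists (fun i t => q i (1 - t)); split.
- by move=> i t; apply: continuous_comp; [exact: crev | exact: cq].
- by move=> i; rewrite subrr q0.
- move=> t /andP[t_gt0 t_lt1] i.
  have t01 : 0 < 1 - t < 1 by rewrite subr_gt0 t_lt1 gtrBl.
  have drev : is_derive t 1 (fun s : R => 1 - s) (-1).
    by apply: is_derive_eq; rewrite add0r mul1r.
  apply: (is_derive_eq (@is_derive1_comp R (q i) (fun s => 1 - s) t _ _ (dq _ t01 i) drev)).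
  rewrite mulrN1 -sumrN; apply: eq_bigr => j _.
  by rewrite mulNr opprK opprB addrC subrK.
Qed.

End LinearODE.

(** * Complex-valued calculus through real and imaginary parts, and the conserved pairing *)

Section ComplexCalculus.
Variable R : realType.
Local Notation C := R[i].
Local Notation Re := complex.Re.
Local Notation Im := complex.Im.
Implicit Types (x y : C).

Lemma ReD x y : Re (x + y) = Re x + Re y. Proof. by case: x y => ? ? []. Qed.
Lemma ImD x y : Im (x + y) = Im x + Im y. Proof. by case: x y => ? ? []. Qed.
Lemma ReM x y : Re (x * y) = Re x * Re y - Im x * Im y.
Proof. by case: x y => ? ? []. Qed.
Lemma ImM x y : Im (x * y) = Re x * Im y + Im x * Re y.
Proof. by case: x y => ? ? []. Qed.

Definition Re_sum := big_morph (@complex.Re R) ReD (erefl : Re 0 = 0).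
Definition Im_sum := big_morph (@complex.Im R) ImD (erefl : Im 0 = 0).

Lemma complex_eq x y : Re x = Re y -> Im x = Im y -> x = y.
Proof. by case: x y => ? ? [? ?] /= -> ->. Qed.

(** The domain is an arbitrary topological space so that it can also be [0,1] with its subspace
    topology, for which this notion unfolds to the same thing as [ccont_on01]. *)
Definition ccontinuous {T : topologicalType} (f : T -> C) :=
  continuous (fun t => Re (f t)) /\ continuous (fun t => Im (f t)).

Lemma ccontinuous_cst (T : topologicalType) x : ccontinuous (fun _ : T => x).
Proof. by split=> t; exact: cst_continuous. Qed.

Lemma ccontinuousD (T : topologicalType) (f g : T -> C) :
  ccontinuous f -> ccontinuous g -> ccontinuous (fun t => f t + g t).
Proof.
move=> [rf jf] [rg jg]; split => t.
  by under eq_fun do rewrite ReD; exact: (continuousD (rf t) (rg t)).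
by under eq_fun do rewrite ImD; exact: (continuousD (jf t) (jg t)).
Qed.

Lemma ccontinuousM (T : topologicalType) (f g : T -> C) :
  ccontinuous f -> ccontinuous g -> ccontinuous (fun t => f t * g t).
Proof.
move=> [rf jf] [rg jg]; split => t.
  under eq_fun do rewrite ReM.
  exact: (continuousB (continuousM (rf t) (rg t)) (continuousM (jf t) (jg t))).
under eq_fun do rewrite ImM.
exact: (continuousD (continuousM (rf t) (jg t)) (continuousM (jf t) (rg t))).
Qed.

Lemma ccontinuous_sum (T : topologicalType) (I : Type) (r : seq I) (P : pred I)
    (f : I -> T -> C) : (forall i, ccontinuous (f i)) ->
  ccontinuous (fun t => \sum_(i <- r | P i) f i t).
Proof.
move=> cf; elim: r => [|i r IH].
  by under eq_fun do rewrite big_nil; exact: ccontinuous_cst.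
under eq_fun do rewrite big_cons.
by case: (P i) => //; apply: ccontinuousD.
Qed.

Lemma ccontinuous_conj (T : topologicalType) (f : T -> C) :
  ccontinuous f -> ccontinuous (fun t => conjc (f t)).
Proof.
move=> [rf jf]; split => t.
  rewrite (_ : (fun s => Re (conjc (f s))) = (fun s => Re (f s))); first exact: rf.
  by apply/funext => s; case: (f s).
rewrite (_ : (fun s => Im (conjc (f s))) = (fun s => - Im (f s))).
  exact: (continuousN (jf t)).
by apply/funext => s; case: (f s).
Qed.

Lemma has_cderivM (f g : R -> C) (s : R) x y : has_cderiv f s x -> has_cderiv g s y ->
  has_cderiv (fun t => f t * g t) s (x * g s + f s * y).
Proof.
move=> [rf jf] [rg jg]; split.
  under eq_fun do rewrite ReM.
  apply: is_derive_eq; rewrite ReD !ReM /GRing.scale/=; ring.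
under eq_fun do rewrite ImM.
apply: is_derive_eq; rewrite ImD !ImM /GRing.scale/=; ring.
Qed.

Lemma has_cderiv_sum n (f : 'I_n -> R -> C) (s : R) (x : 'I_n -> C) :
  (forall i, has_cderiv (f i) s (x i)) ->
  has_cderiv (fun t => \sum_i f i t) s (\sum_i x i).
Proof.
move=> df; split.
  under eq_fun do rewrite Re_sum; rewrite Re_sum -fct_sumE.
  by apply: is_derive_sum => i; exact: (df i).1.
under eq_fun do rewrite Im_sum; rewrite Im_sum -fct_sumE.
by apply: is_derive_sum => i; exact: (df i).2.
Qed.

Lemma has_cderiv_conj (f : R -> C) (s : R) x :
  has_cderiv f s x -> has_cderiv (fun t => conjc (f t)) s (conjc x).
Proof.
move=> [rf jf]; split.
  rewrite (_ : (fun t => Re (conjc (f t))) = (fun t => Re (f t))); last first.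
    by apply/funext => t; case: (f t).
  by rewrite (_ : Re (conjc x) = Re x)//; case: (x).
rewrite (_ : (fun t => Im (conjc (f t))) = (fun t => - Im (f t))); last first.
  by apply/funext => t; case: (f t).
rewrite (_ : Im (conjc x) = - Im x); last by case: (x).
exact: is_deriveN.
Qed.

(** The mean value theorem is applied to the real and imaginary parts separately, as it fails for
    complex-valued functions. *)
Lemma has_cderiv0_const (f : R -> C) : ccont_on01 f ->
  (forall s, 0 < s < 1 -> has_cderiv f s 0) -> f 1 = f 0.
Proof.
move=> [rf jf] df.
have const (g : R -> R) : {within `[0, 1], continuous g}%classic ->
    (forall s : R, 0 < s < 1 -> is_derive s 1 g 0) -> g 1 = g 0.
  move=> cg dg; apply/eqP; rewrite -subr_eq0.
  have dg' (s : R) : s \in `]0, 1[ -> is_derive s 1 g 0.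
    by rewrite in_itv; exact: dg.
  by have [c _ ->] := MVT (@ltr01 R) dg' cg; rewrite mul0r.
apply: complex_eq.
  by apply: (const (fun t => Re (f t))) => // s /df[].
by apply: (const (fun t => Im (f t))) => // s /df[].
Qed.

(* The system over C is a real one indexed by 'I_n * bool, (i, b) standing for
   the real (b = false) or imaginary (b = true) part of the i-th coordinate. *)
Lemma complex_linear_ode_exists n (F : R -> 'M[C]_n) (v : 'cV[C]_n) (t0 : R) :
  (forall i j, ccontinuous (fun s => F s i j)) -> t0 = 0 \/ t0 = 1 ->
  exists q : R -> 'cV[C]_n,
  [/\ forall i, ccontinuous (fun t => q t i 0), q t0 = v &
   forall s, 0 < s < 1 -> forall i,
     has_cderiv (fun t => q t i 0) s ((F s *m q s) i 0)].
Proof.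
move=> cF t0E.
(* Each entry z of F is replaced by the real 2 x 2 matrix of multiplication by z, with rows (Re z, -
   Im z) and (Im z, Re z). *)
pose a (p r : 'I_n * bool) s := let z := F s p.1 r.1 in
  if p.2 then (if r.2 then Re z else Im z) else (if r.2 then - Im z else Re z).
have ca p r : continuous (a p r).
  case: p r => [i b] [j c]; have [rF jF] := cF i j.
  case: b c => [] [] //= t; exact: (continuousN (jF t)).
pose w (p : 'I_n * bool) := if p.2 then Im (v p.1 0) else Re (v p.1 0).
have [q [cq q0 dq]] := linear_ode_exists R _ a w t0 ca t0E.
have sum_pairE (f : 'I_n * bool -> R) :
    \sum_p f p = \sum_j (f (j, true) + f (j, false)).
  transitivity (\sum_j \sum_b f (j, b)).
    by rewrite pair_bigA; apply: eq_bigr => -[].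
  by apply: eq_bigr => j _; rewrite big_bool.
exists (fun t => \col_i (q (i, false) t +i* q (i, true) t)%C); split.
- by move=> i; split => t;
    under eq_fun do rewrite mxE/=; exact: cq.
- apply/colP => i; rewrite mxE !q0 /w /=; exact: complex_eq.
- move=> s s01 i; split; under eq_fun do rewrite mxE/=.
    apply: (is_derive_eq (dq s s01 (i, false))).
    rewrite sum_pairE.
    rewrite mxE Re_sum; apply: eq_bigr => j _.
    by rewrite /a/= ReM mxE/=; ring.
  apply: (is_derive_eq (dq s s01 (i, true))).
  rewrite sum_pairE.
  rewrite mxE Im_sum; apply: eq_bigr => j _.
  by rewrite /a/= ImM mxE/=; ring.
Qed.

Lemma adjmxM m n p (A : 'M[C]_(m, n)) (B : 'M[C]_(n, p)) :
  adjmx (A *m B) = adjmx B *m adjmx A.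
Proof. by rewrite /adjmx map_mxM trmx_mul. Qed.

Lemma adjmxB m n (A B : 'M[C]_(m, n)) : adjmx (A - B) = adjmx A - adjmx B.
Proof. by rewrite /adjmx map_mxB linearB. Qed.

Lemma adjmxN m n (A : 'M[C]_(m, n)) : adjmx (- A) = - adjmx A.
Proof. by rewrite /adjmx map_mxN linearN. Qed.

Lemma adjmxK m n (A : 'M[C]_(m, n)) : adjmx (adjmx A) = A.
Proof. by apply/matrixP => i j; rewrite !mxE conjcK. Qed.

(** Testing against the basis vectors reads off the conjugated coordinates of w. This turns an
    identity for all v into the vanishing of a single vector. *)
Lemma adjmx_mul_eq0 n (w : 'cV[C]_n) :
  (forall v : 'cV[C]_n, adjmx w *m v = 0) <-> w = 0.
Proof.
split=> [H|-> v]; last by rewrite /adjmx map_mx0 trmx0 mul0mx.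
rewrite -[w]adjmxK; suff -> : adjmx w = 0 by rewrite /adjmx map_mx0 trmx0.
apply/rowP => j; have /matrixP/(_ 0 0) := H (delta_mx j 0).
by rewrite -colE !mxE.
Qed.

(** The product rule gives (p^* q)' = (G p)^* q + p^* F q, and the two terms cancel because G^* = -
    F. *)
Lemma adjoint_solution_invariant d N (F G : R -> 'M[C]_(N * d))
    (q p : R -> 'cV[C]_(N * d)) : (forall s, G s = - adjmx (F s)) ->
  is_lin_sol F q -> is_lin_sol G p ->
  adjmx (p 1) *m q 1 = adjmx (p 0) *m q 0.
Proof.
move=> GF [cq dq] [cp dp].
pose f t := \sum_i conjc (p t i 0) * q t i 0.
have fE t : (adjmx (p t) *m q t) = (f t)%:M.
  by apply/matrixP => i j; rewrite !ord1 !mxE eqxx; apply: eq_bigr => k _; rewrite !mxE.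
rewrite !fE (has_cderiv0_const f)//.
  (* The closure properties of [ccontinuous] are used here for the subspace topology of [0,1]. *)
  apply: ccontinuous_sum => i.
  by apply: ccontinuousM; [apply: ccontinuous_conj; exact: cp | exact: cq].
move=> s s01.
have -> : 0 = \sum_i (conjc ((G s *m p s) i 0) * q s i 0 +
                      conjc (p s i 0) * (F s *m q s) i 0).
  rewrite big_split/=.
  have -> : \sum_i conjc ((G s *m p s) i 0) * q s i 0 =
      (adjmx (G s *m p s) *m q s) 0 0.
    by rewrite [RHS]mxE; apply: eq_bigr => i _; rewrite !mxE.
  have -> : \sum_i conjc (p s i 0) * (F s *m q s) i 0 =
      (adjmx (p s) *m (F s *m q s)) 0 0.
    by rewrite [RHS]mxE; apply: eq_bigr => i _; rewrite !mxE.
  by rewrite adjmxM GF adjmxN adjmxK mulmxN mulNmx mulmxA mxE addNr.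
apply: has_cderiv_sum => i; apply: has_cderivM; last exact: dq.
by apply: has_cderiv_conj; exact: dp.
Qed.

End ComplexCalculus.

(** * The adjoint relation between the two boundary operators of the delay system *)

Section Delay.
Variables (R : realType) (d N h : nat) (Delta : R) (nj : 'I_h.+1 -> nat)
  (Aj : 'I_h.+1 -> R -> 'M[R]_d).
Local Notation C := R[i].

Lemma map_conj_sum m n (I : Type) (r : seq I) (P : pred I) (M : I -> 'M[C]_(m, n)) :
  map_mx (@conjc R) (\sum_(i <- r | P i) M i) =
  \sum_(i <- r | P i) map_mx (@conjc R) (M i).
Proof.
apply: (big_morph (map_mx (@conjc R))) => [A B|]; first exact: map_mxD.
exact: map_mx0.
Qed.

(** [Delta] and the entries of [Aj] are real, and conjugation commutes with integer powers, so only
    [mu] is affected. *)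
Lemma map_conj_Amx s (mu : C) :
  map_mx (@conjc R) (Amx N Delta nj Aj s mu) = Amx N Delta nj Aj s (conjc mu).
Proof.
rewrite /Amx map_conj_sum; apply: eq_bigr => n _.
rewrite map_conj_sum; apply: eq_bigr => j _.
rewrite map_conj_sum; apply: eq_bigr => m _.
rewrite map_conj_sum; apply: eq_bigr => r _.
rewrite map_conj_sum; apply: eq_bigr => c _.
rewrite map_mxZ map_delta_mx !rmorphM fmorphXz !mxE.
by congr (_ * _ * _ *: _); exact: conjc_real.
Qed.

Lemma map_conj_Bmx (mu : C) :
  map_mx (@conjc R) (Bmx d N mu) = Bmx d N (conjc mu).
Proof.
rewrite /Bmx map_conj_sum; apply: eq_bigr => n _.
rewrite map_conj_sum; apply: eq_bigr => m _.
rewrite map_conj_sum; apply: eq_bigr => r _.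
rewrite map_mxZ map_delta_mx !mxE; congr (_ *: _).
by case: ifP => _; [exact: conjc1 | case: ifP => _ //; exact: conjc0].
Qed.

Hypothesis cAj : forall j r c, continuous (fun t => Aj j t r c).

Lemma ccontinuous_Amx (mu : C) i k :
  ccontinuous R (fun s => Amx N Delta nj Aj s mu i k).
Proof.
under eq_fun do rewrite /Amx summxE.
apply: ccontinuous_sum => n.
under eq_fun do rewrite summxE.
apply: ccontinuous_sum => j.
under eq_fun do rewrite summxE.
apply: ccontinuous_sum => m.
under eq_fun do rewrite summxE.
apply: ccontinuous_sum => r.
under eq_fun do rewrite summxE.
apply: ccontinuous_sum => c.
under eq_fun do rewrite mxE.
apply: ccontinuousM; last exact: ccontinuous_cst.
apply: ccontinuousM; first exact: ccontinuous_cst.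
split; under eq_fun do rewrite /cplx_mx mxE/=; last by move=> ?; exact: cst_continuous.
have cs : continuous (fun s : R => (s + n%:R) * Delta).
  have c1 (s : R) : {for s, continuous (fun s : R => s + n%:R)}.
    by apply: continuousD; [exact: id | exact: cst_continuous].
  by move=> s; exact: (continuousM (c1 s) (@cst_continuous _ _ _ s)).
move=> s; have cA := cAj j r c ((s + n%:R) * Delta).
exact: (continuous_comp (g := fun t => Aj j t r c) (cs s) cA).
Qed.

Lemma Nop_Mop_adjoint (mu : C) (u v : 'cV[C]_(N * d)) :
  adjmx u *m Nop Delta nj Aj mu v = adjmx (Mop Delta nj Aj (conjc mu) u) *m v.
Proof.
pose F s := Amx N Delta nj Aj s mu.
pose G s := - (Amx N Delta nj Aj s (conjc mu))^T.
have GF s : G s = - adjmx (F s) by rewrite /G /F /adjmx map_conj_Amx.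
have cF i j : ccontinuous R (fun s => F s i j) := ccontinuous_Amx mu i j.
have cG i j : ccontinuous R (fun s => G s i j).
  have -> : (fun s => G s i j) = (fun s => -1 * conjc (F s j i)).
    by apply/funext => s; rewrite GF !mxE mulN1r.
  apply: ccontinuousM; first exact: ccontinuous_cst.
  exact: ccontinuous_conj.
have solution (M : R -> 'M[C]_(N * d)) (w : 'cV[C]_(N * d)) (t0 : R) :
    (forall i j, ccontinuous R (fun s => M s i j)) -> t0 = 0 \/ t0 = 1 ->
    exists2 q, is_lin_sol M q & q t0 = w.
  move=> cM /(complex_linear_ode_exists _ _ M w t0 cM)[q [cq qw dq]].
  exists q => //; split=> [i|//]; have [rq jq] := cq i.
  by split; exact: continuous_subspaceT.
rewrite /Nop /Mop.
set Q := xget _ _; set P := xget _ _.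
(* Existence of a solution makes the set inhabited, so [xget] returns the endpoint of an actual
   solution and not its default value 0. *)
have [q [solq [q0 ->]]] :
    exists q, is_lin_sol F q /\ q 0 = v /\ Q = q 1.
  apply: (@xgetPex _ 0 [set w | exists q, is_lin_sol F q /\ q 0 = v /\ w = q 1]%classic).
  by have [q solq q0] := solution F v 0 cF (or_introl erefl); exists (q 1), q.
have [p [solp [p1 ->]]] :
    exists p, is_lin_sol G p /\ p 1 = u /\ P = p 0.
  apply: (@xgetPex _ 0 [set w | exists p, is_lin_sol G p /\ p 1 = u /\ w = p 0]%classic).
  by have [p solp p1] := solution G u 1 cG (or_intror erefl); exists (p 0), p.
have := adjoint_solution_invariant _ _ _ F G q p GF solq solp.
rewrite q0 p1 mulmxBr adjmxB mulmxBl => ->; congr (_ - _).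
(* The transpose of B(conj mu) is the adjoint of B(mu), so the boundary terms agree by taking the
   adjoint twice. *)
by rewrite adjmxM -map_conj_Bmx adjmxK mulmxA.
Qed.

End Delay.

Theorem theorem4p1 (R : realType) (d N h : nat) (Delta : R)
  (nj : 'I_h.+1 -> nat) (Aj : 'I_h.+1 -> R -> 'M[R]_d)
  (HN : (0 < N)%N) (HDelta : 0 < Delta)
  (Hn0 : nj ord0 = 0%N)
  (Hninc : forall i j : 'I_h.+1, (0 < i)%N -> (i < j)%N -> (nj i < nj j)%N)
  (Hsmooth : forall j r c, smooth_fun (fun t => Aj j t r c))
  (Hper : forall j t, Aj j (t + N%:R * Delta) = Aj j t)
  (u : 'cV[R[i]]_(N * d)) (mu : R[i]) (Hmu : mu != 0) :
  (u != 0 /\ forall v, adjmx u *m Nop Delta nj Aj mu v = 0)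
  <->
  (u != 0 /\ Mop Delta nj Aj (conjc mu) u = 0).
Proof.
have cAj j r c : continuous (fun t => Aj j t r c).
  move=> t; apply/differentiable_continuous/derivable1_diffP.
  (* The derivative of order 0 is the function itself, so this instance of smoothness is its
     derivability. *)
  exact: (Hsmooth j r c 0).
have adj := Nop_Mop_adjoint R d N h Delta nj Aj cAj mu u.
split=> -[u0 H]; split=> //.
  by apply/adjmx_mul_eq0 => v; rewrite -adj.
by move=> v; rewrite adj; exact: (adjmx_mul_eq0 _ _ _).2.
Qed.
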